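(* Let $S$ be a phased ring for which $R=S^{\mathrm{pos}}$ has square roots. Then: 1. Every non-zero $s\in S$ has $s=r\cdot u$ for a unique $r\in R$ and unitary $u\in S$. 2. $R$ is totally ordered under the relation $a\le b$ whenever $a+c=b$ for some $c\in R$. 3. $D(R)\simeq S^{\mathrm{sa}}:=\{s\in S\mid s^\dagger=s\}$. 4. Either $S=S^{\mathrm{sa}}$ with trivial involution, or $S$ has square roots and $S=S^{\mathrm{sa}}[i]$.
   Context: A phased ring is a commutative ring $S$ with an involution $\dagger$ (a ring automorphism with $s^{\dagger\dagger}=s$), which is an integral domain (meaning $ab=0\Rightarrow a=0$ or $b=0$), such that for all $a,b\in S$ there is $c\in S$ with $a^\dagger a+b^\dagger b=c^\dagger c$, and any such $c$ satisfies $a=cd$ and $b=ce$ for some $d,e\in S$. $S^{\mathrm{pos}}=\{s^\dagger s\mid s\in S\}$, which is a sub-semi-ring of $S$. An element $u\in S$ is unitary if $u^\dagger u=1$. A semi-ring $R$ has square roots if every $a\in R$ has $a=b^2$ for some $b\in R$. For a semi-ring $R$, its difference ring $D(R)$ consists of pairs $(a,b)$ of elements of $R$, with $(a,b)$ and $(c,d)$ identified whenever $a+d=b+c$, with addition and multiplication defined by interpreting $(a,b)$ as ''$a-b$''. For a commutative ring $T$, $T[i]$ is the involutive ring with elements of the form $a+b\cdot i$ for $a,b\in T$, where $1=-i^2=i\cdot i^\dagger$ and $a^\dagger=a$ for all $a\in T$. *)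

(* Defs.v *)
From HB Require Import structures.
From Stdlib Require Relation_Operators.
From mathcomp Require Import all_boot all_algebra generic_quotient ssrAC.
From mathcomp Require Import boolp.

Set Implicit Arguments.
Unset Strict Implicit.
Unset Printing Implicit Defensive.

Import GRing.Theory.
Local Open Scope ring_scope.
Local Open Scope quotient_scope.

(* Rings are taken in the possibly trivial (Pz) hierarchy: the definition of a
   phased ring does not require 1 != 0. *)

HB.mixin Record isInvolutive S of GRing.ComPzRing S := {
  dag : S -> S;
  dagD : {morph dag : x y / x + y};
  dagM : {morph dag : x y / x * y};
  dag1 : dag 1 = 1;
  dagK : involutive dag
}.

#[short(type="involutiveRingType")]
HB.structure Definition InvolutiveRing :=
  {S of isInvolutive S & GRing.ComPzRing S}.

Lemma dag0 (S : involutiveRingType) : dag 0 = 0 :> S.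
Proof. by apply: (addrI (dag 0)); rewrite -dagD !addr0. Qed.

HB.instance Definition _ (S : involutiveRingType) :=
  GRing.isNmodMorphism.Build S S (@dag S) (conj (@dag0 S) (@dagD S)).
HB.instance Definition _ (S : involutiveRingType) :=
  GRing.isMonoidMorphism.Build S S (@dag S) (conj (@dag1 S) (@dagM S)).

HB.mixin Record InvolutiveRing_isPhased S of InvolutiveRing S := {
  phased_domain : forall a b : S, a * b = 0 -> a = 0 \/ b = 0;
  phased_sum : forall a b : S,
    exists c : S, dag a * a + dag b * b = dag c * c;
  phased_div : forall a b c : S, dag a * a + dag b * b = dag c * c ->
    exists d e : S, a = c * d /\ b = c * e
}.

#[short(type="phasedRingType")]
HB.structure Definition PhasedRing :=
  {S of InvolutiveRing_isPhased S & InvolutiveRing S}.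

Definition unitary (S : involutiveRingType) (u : S) : Prop := dag u * u = 1.

Definition has_square_roots (R : pzSemiRingType) : Prop :=
  forall a : R, exists b : R, a = b ^+ 2.

Definition semiring_le (R : pzSemiRingType) (a b : R) : Prop :=
  exists c : R, a + c = b.

Definition is_pos (S : involutiveRingType) : {pred S} :=
  fun x => `[< exists s : S, x = dag s * s >].

Record posElt (S : involutiveRingType) :=
  PosElt { pos_val :> S; pos_valP : pos_val \in @is_pos S }.

HB.instance Definition _ (S : involutiveRingType) :=
  [isSub for @pos_val S].
HB.instance Definition _ (S : involutiveRingType) :=
  [Choice of posElt S by <:].

Lemma is_pos_semiring_closed (S : phasedRingType) : semiring_closed (@is_pos S).
Proof.
split; split.
- by apply/asboolP; exists 0; rewrite mulr0.
- move=> _ _ /asboolP[a ->] /asboolP[b ->]; apply/asboolP; exact: phased_sum.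
- by apply/asboolP; exists 1; rewrite dag1 mulr1.
- move=> _ _ /asboolP[a ->] /asboolP[b ->]; apply/asboolP; exists (a * b).
  by rewrite dagM mulrACA.
Qed.

HB.instance Definition _ (S : phasedRingType) :=
  GRing.SubChoice_isSubComPzSemiRing.Build S (@is_pos S) (posElt S)
    (@is_pos_semiring_closed S).

Definition is_sa (S : involutiveRingType) : {pred S} := fun s => dag s == s.

Record saElt (S : involutiveRingType) :=
  SaElt { sa_val :> S; sa_valP : sa_val \in @is_sa S }.

HB.instance Definition _ (S : involutiveRingType) := [isSub for @sa_val S].
HB.instance Definition _ (S : involutiveRingType) := [Choice of saElt S by <:].

Lemma is_sa_subring_closed (S : involutiveRingType) :
  subring_closed (@is_sa S).
Proof.
split.
- by apply/eqP; rewrite dag1.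
- by move=> a b /eqP ha /eqP hb; apply/eqP; rewrite rmorphB /= ha hb.
- by move=> a b /eqP ha /eqP hb; apply/eqP; rewrite dagM ha hb.
Qed.

HB.instance Definition _ (S : involutiveRingType) :=
  GRing.SubChoice_isSubComPzRing.Build S (@is_sa S) (saElt S)
    (@is_sa_subring_closed S).

(* When R is not cancellative the relation a + d = b + c need not be
   transitive, so the difference ring is the quotient by the equivalence
   relation it generates. *)

Definition diff_step (R : pzSemiRingType) (p q : R * R) : Prop :=
  p.1 + q.2 = p.2 + q.1.

Definition diff_rel (R : pzSemiRingType) : rel (R * R) := fun p q =>
  `[< Relation_Operators.clos_refl_sym_trans (R * R) (@diff_step R) p q >].

Section DifferenceRing.
Variable R : pzSemiRingType.
Implicit Types p q r : (R * R)%type.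

Lemma diff_rel_refl : reflexive (@diff_rel R).
Proof. by move=> p; apply/asboolP; apply: Relation_Operators.rst_refl. Qed.

Lemma diff_rel_sym : symmetric (@diff_rel R).
Proof.
by move=> p q; apply/asboolP/asboolP; apply: Relation_Operators.rst_sym.
Qed.

Lemma diff_rel_trans : transitive (@diff_rel R).
Proof.
move=> q p r /asboolP pq /asboolP qr; apply/asboolP.
exact: Relation_Operators.rst_trans pq qr.
Qed.

Canonical diff_equiv :=
  EquivRel (@diff_rel R) diff_rel_refl diff_rel_sym diff_rel_trans.

Definition diffRing := {eq_quot (@diff_rel R)}.

HB.instance Definition _ : EqQuotient _ (@diff_rel R) diffRing :=
  EqQuotient.on diffRing.
HB.instance Definition _ := Choice.on diffRing.

Lemma diff_step_rel p q : diff_step p q -> diff_rel p q.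
Proof. by move=> h; apply/asboolP; apply: Relation_Operators.rst_step. Qed.

Lemma diff_relP p q :
  reflect (exists k, p.1 + q.2 + k = p.2 + q.1 + k) (diff_rel p q).
Proof.
apply: (iffP idP) => [/asboolP|[k e]].
  elim=> {p q} [p q h|p|p q _ [k h]|p q r _ [k h] _ [l h']].
  - by exists 0; rewrite h.
  - by exists 0; rewrite [p.1 + _]addrC.
  - by exists k; rewrite [q.1 + _]addrC [q.2 + _]addrC h.
  - exists (q.1 + q.2 + k + l).
    rewrite (AC (2*4) ((1*4*5)*(3*2*6)))/= h h'.
    by rewrite (AC (3*3) ((1*5)*(2*4*3*6)))/=.
apply: (@diff_rel_trans (p.1 + (q.2 + k), p.2 + (q.2 + k))).
  by apply: diff_step_rel; rewrite /diff_step /= addrCA.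
apply: diff_step_rel; rewrite /diff_step /= !addrA e.
by rewrite (AC 4 (1*4*3*2)).
Qed.

Lemma diff_rel_map (f : R * R -> R * R) :
  (forall p q, diff_step p q -> diff_step (f p) (f q)) ->
  forall p q, diff_rel p q -> diff_rel (f p) (f q).
Proof.
move=> fstep p q /asboolP; elim=> {p q} [p q /fstep/diff_step_rel //|p|p q _|].
- exact: diff_rel_refl.
- by rewrite diff_rel_sym.
- by move=> p q r _ pq _; apply: diff_rel_trans.
Qed.

Definition diff_add0 p q := (p.1 + q.1, p.2 + q.2).
Definition diff_opp0 p := (p.2, p.1).
Definition diff_mul0 p q :=
  (p.1 * q.1 + p.2 * q.2, p.1 * q.2 + p.2 * q.1).

Definition diff_zero : diffRing := \pi_diffRing (0, 0).
Definition diff_one : diffRing := \pi_diffRing (1, 0).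
Definition diff_add := lift_op2 diffRing diff_add0.
Definition diff_opp := lift_op1 diffRing diff_opp0.
Definition diff_mul := lift_op2 diffRing diff_mul0.

Lemma pi_diff2 (op : R * R -> R * R -> R * R) :
  (forall r p q, diff_step p q -> diff_step (op p r) (op q r)) ->
  (forall r p q, diff_step p q -> diff_step (op r p) (op r q)) ->
  {morph \pi_diffRing : p q / op p q >-> lift_op2 diffRing op p q}.
Proof.
move=> opl opr p q; unlock; apply/eqmodP => /=.
have reprE r : diff_rel r (repr (\pi_diffRing r)).
  by apply/eqmodP; rewrite reprK.
apply: (@diff_rel_trans (op (repr (\pi_diffRing p)) q)).
  exact: (diff_rel_map (opl q)).
exact: (diff_rel_map (opr _)).
Qed.

Lemma pi_diff_add :
  {morph \pi : p q / diff_add0 p q >-> diff_add p q}.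
Proof.
apply: pi_diff2 => r p q; rewrite /diff_step /= => h.
  by rewrite addrACA [RHS]addrACA h [r.1 + _]addrC.
by rewrite addrACA [RHS]addrACA h [r.1 + _]addrC.
Qed.
Canonical pi_diff_add_morph := PiMorph2 pi_diff_add.

Lemma pi_diff_opp : {morph \pi : p / diff_opp0 p >-> diff_opp p}.
Proof.
move=> p; unlock diff_opp; apply/eqmodP => /=; apply: diff_rel_map.
  by move=> a b; rewrite /diff_step /= => ->.
by apply/eqmodP; rewrite reprK.
Qed.
Canonical pi_diff_opp_morph := PiMorph1 pi_diff_opp.

Lemma pi_diff_mul :
  {morph \pi : p q / diff_mul0 p q >-> diff_mul p q}.
Proof.
apply: pi_diff2 => r p q; rewrite /diff_step /= => h.
- rewrite (AC (2*2) ((1*4)*(2*3)))/= [RHS](AC (2*2) ((1*4)*(2*3)))/=.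
  by rewrite -!mulrDl h addrC.
- rewrite (AC (2*2) ((1*3)*(2*4)))/= [RHS](AC (2*2) ((1*3)*(2*4)))/=.
  by rewrite -!mulrDr h.
Qed.
Canonical pi_diff_mul_morph := PiMorph2 pi_diff_mul.

Lemma diff_addA : associative diff_add.
Proof.
elim/quotW=> p; elim/quotW=> q; elim/quotW=> r.
by rewrite -!pi_diff_add /diff_add0 /= !addrA.
Qed.

Lemma diff_addC : commutative diff_add.
Proof.
elim/quotW=> p; elim/quotW=> q.
by rewrite -!pi_diff_add /diff_add0 [p.1 + _]addrC [p.2 + _]addrC.
Qed.

Lemma diff_add0r : left_id diff_zero diff_add.
Proof.
by elim/quotW=> -[a b]; rewrite -!pi_diff_add /diff_add0 /= !add0r.
Qed.

Lemma diff_addNr : left_inverse diff_zero diff_opp diff_add.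
Proof.
elim/quotW=> p; rewrite -pi_diff_opp -pi_diff_add; apply/eqmodP.
by apply: diff_step_rel; rewrite /diff_step /= !addr0 addrC.
Qed.

HB.instance Definition _ :=
  GRing.isZmodule.Build diffRing diff_addA diff_addC diff_add0r diff_addNr.

Lemma diff_mulA : associative diff_mul.
Proof.
elim/quotW=> p; elim/quotW=> q; elim/quotW=> r.
rewrite -!pi_diff_mul /diff_mul0 /= !mulrDl !mulrDr !mulrA.
by congr (\pi_diffRing (_, _)); rewrite (AC (2*2) ((1*4)*(2*3))).
Qed.

Lemma diff_mul1r : left_id diff_one diff_mul.
Proof.
by elim/quotW=> -[a b]; rewrite -pi_diff_mul /diff_mul0 /= !mul1r !mul0r !addr0.
Qed.

Lemma diff_mulr1 : right_id diff_one diff_mul.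
Proof.
elim/quotW=> -[a b].
by rewrite -pi_diff_mul /diff_mul0 /= !mulr1 !mulr0 addr0 add0r.
Qed.

Lemma diff_mulDl : left_distributive diff_mul diff_add.
Proof.
elim/quotW=> p; elim/quotW=> q; elim/quotW=> r.
rewrite -pi_diff_add -!pi_diff_mul -pi_diff_add /diff_add0 /diff_mul0 /=.
by rewrite !mulrDl; congr (\pi_diffRing (_, _)); rewrite addrACA.
Qed.

Lemma diff_mulDr : right_distributive diff_mul diff_add.
Proof.
elim/quotW=> p; elim/quotW=> q; elim/quotW=> r.
rewrite -pi_diff_add -!pi_diff_mul -pi_diff_add /diff_add0 /diff_mul0 /=.
by rewrite !mulrDr; congr (\pi_diffRing (_, _)); rewrite addrACA.
Qed.

HB.instance Definition _ := GRing.Zmodule_isPzRing.Build diffRing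
  diff_mulA diff_mul1r diff_mulr1 diff_mulDl diff_mulDr.

End DifferenceRing.

(* T[i]: the pair (a, b) stands for a + b i, with i ^+ 2 = -1 and
   dag i = - i. *)

Definition adjoin_i (T : comPzRingType) : Type := (T * T)%type.

Section AdjoinI.
Variable T : comPzRingType.
Local Notation Ti := (adjoin_i T).
Implicit Types x y z : Ti.

HB.instance Definition _ := GRing.Zmodule.copy Ti (T * T)%type.

Definition ai_one : Ti := (1, 0).
Definition ai_mul x y : Ti :=
  (x.1 * y.1 - x.2 * y.2, x.1 * y.2 + x.2 * y.1).
Definition ai_dag x : Ti := (x.1, - x.2).

Lemma ai_mulA : associative ai_mul.
Proof.
move=> x y z; rewrite /ai_mul /= !(mulrDl, mulrDr, mulrN, mulNr) !mulrA !opprD.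
by congr pair; rewrite (AC (2*2) ((1*4)*(2*3))).
Qed.

Lemma ai_mulC : commutative ai_mul.
Proof.
move=> x y; rewrite /ai_mul [y.1 * x.1]mulrC [y.2 * x.2]mulrC.
by rewrite [y.1 * x.2]mulrC [y.2 * x.1]mulrC [x.2 * _ + _]addrC.
Qed.

Lemma ai_mul1r : left_id ai_one ai_mul.
Proof. by case=> a b; rewrite /ai_mul /= !mul1r !mul0r subr0 addr0. Qed.

Lemma ai_mulDl : left_distributive ai_mul +%R.
Proof.
move=> x y z; rewrite /ai_mul /= !mulrDl opprD.
by congr pair; rewrite addrACA.
Qed.

HB.instance Definition _ := GRing.Zmodule_isComPzRing.Build Ti
  ai_mulA ai_mulC ai_mul1r ai_mulDl.

Lemma ai_dagD : {morph ai_dag : x y / x + y}.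
Proof. by move=> x y; rewrite /ai_dag /= opprD. Qed.

Lemma ai_dagM : {morph ai_dag : x y / x * y}.
Proof.
move=> x y; rewrite /ai_dag; congr pair => /=.
  by rewrite mulrNN.
by rewrite mulrN mulNr opprD.
Qed.

Lemma ai_dag1 : ai_dag 1 = 1.
Proof. by rewrite /ai_dag /= oppr0. Qed.

Lemma ai_dagK : involutive ai_dag.
Proof. by case=> a b; rewrite /ai_dag /= opprK. Qed.

HB.instance Definition _ :=
  isInvolutive.Build Ti ai_dagD ai_dagM ai_dag1 ai_dagK.

Definition ai_emb (a : T) : Ti := (a, 0).
Definition ai_i : Ti := (0, 1).

Lemma ai_i_sq : - ai_i ^+ 2 = 1.
Proof.
rewrite expr2; congr pair => /=; rewrite ?mulr1 ?mulr0 ?mul0r.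
  by rewrite add0r opprK.
by rewrite addr0 oppr0.
Qed.

Lemma ai_i_dag : ai_i * dag ai_i = 1.
Proof.
by congr pair => /=; rewrite ?mul0r ?mul1r ?mulr0 ?sub0r ?opprK ?addr0.
Qed.

Lemma ai_emb_dag a : dag (ai_emb a) = ai_emb a.
Proof. by congr pair; rewrite /= oppr0. Qed.

Lemma ai_embE x : x = ai_emb x.1 + ai_emb x.2 * ai_i.
Proof.
case: x => a b; congr pair => /=.
  by rewrite mulr0 mul0r subr0 addr0.
by rewrite mulr1 mul0r addr0 add0r.
Qed.

End AdjoinI.

(* Main.v *)
(** Taking norms, [s = r u] with [r] the root of [dag s * s] (the phased axiom
    gives divisibility), and [u] is then unitary.  If [s] is self-adjoint then
    so is [u], hence [u ^+ 2 = 1] and [u = 1] or [u = -1]: every self-adjoint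
    element is positive or negative, which gives the order and the difference
    ring.  If [s != dag s], the unitary part [i] of [s - dag s] satisfies
    [dag i = - i], i.e. [i ^+ 2 = -1]; 2 is invertible because [1] is divisible
    by any [c] with [dag c * c = 1 + 1], so real and imaginary parts exist.  A
    unitary [u] other than -1 is the square of the unitary part of [1 + u]. *)

From HB Require Import structures.
Require Import Defs.
From mathcomp Require Import all_boot all_algebra.
From mathcomp Require Import generic_quotient boolp ring.

Set Implicit Arguments.
Unset Strict Implicit.
Unset Printing Implicit Defensive.

Import GRing.Theory.
Local Open Scope ring_scope.

Lemma inj_surj_bijective (A B : Type) (f : A -> B) :
  injective f -> (forall y, exists x, f x = y) -> bijective f.
Proof.
move=> finj /choice[g fg]; exists g => // x.
by apply: finj; rewrite fg.
Qed.

Section PhasedRing.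
Variable S : phasedRingType.
Implicit Types (a b c s u : S) (r p q : posElt S).

(** * Cancellation, positive elements and invertibility of 2 *)

Lemma phased_mulfI c a b : c <> 0 -> c * a = c * b -> a = b.
Proof.
move=> c0 /eqP; rewrite -subr_eq0 -mulrBr => /eqP/phased_domain[//|/eqP].
by rewrite subr_eq0 => /eqP.
Qed.

Lemma phased_sqr_eq a b : a * a = b * b -> a = b \/ a = - b.
Proof.
move=> h; have : (a - b) * (a + b) = 0 by ring: h.
case/phased_domain => /eqP; first by rewrite subr_eq0 => /eqP; left.
by rewrite addr_eq0 => /eqP; right.
Qed.

(** Reduces a goal that follows from an equation scaled by [k] to a polynomial identity that [ring]
    can decide. *)
Lemma eq_of_lincomb (k a b x y : S) : a = b -> x - y = k * (a - b) -> x = y.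
Proof. by move=> -> /eqP; rewrite subrr mulr0 subr_eq0 => /eqP. Qed.
Arguments eq_of_lincomb k {a b x y}.

Lemma dagN a : dag (- a) = - dag a.
Proof. exact: rmorphN. Qed.

Lemma norm_eq0 a : dag a * a = 0 -> a = 0.
Proof.
case/phased_domain=> // h.
by rewrite -[a]dagK h dag0.
Qed.

Lemma posP r : exists s, pos_val r = dag s * s.
Proof. by case: r => x h; apply/asboolP. Qed.

Lemma pos_dag r : dag (pos_val r) = pos_val r.
Proof. by have [s ->] := posP r; rewrite dagM dagK mulrC. Qed.

Lemma pos_norm s : exists r, pos_val r = dag s * s.
Proof.
have h : dag s * s \in @is_pos S by apply/asboolP; exists s.
by exists (PosElt h).
Qed.

Lemma posD_eq0 p q : pos_val p + pos_val q = 0 -> pos_val p = 0.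
Proof.
have [a ->] := posP p; have [b ->] := posP q => h.
(* The sum is the norm of 0, so the divisibility axiom makes [a] a multiple of 0. *)
have [|d [e [-> _]]] := @phased_div S a b 0; first by rewrite h mulr0.
by rewrite mul0r mulr0.
Qed.

Lemma pos_val_inj : injective (@pos_val S).
Proof. exact: val_inj. Qed.

Lemma pos_sqr_inj p q :
  pos_val p * pos_val p = pos_val q * pos_val q -> p = q.
Proof.
move=> h; apply: pos_val_inj; case: (phased_sqr_eq h) => // e.
have p0 : pos_val p = 0 by apply: (@posD_eq0 p q); rewrite e addNr.
(* In the case [p = - q] the two positives sum to 0, so both vanish and still agree. *)
by rewrite p0; move/eqP: e; rewrite p0 eq_sym oppr_eq0 => /eqP.
Qed.

Lemma two_unit : exists h : S, (1 + 1) * h = 1 /\ dag h = h.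
Proof.
have [c hc] := phased_sum (1 : S) 1.
have [d [_ [e _]]] := phased_div _ _ _ hc.
rewrite dag1 mulr1 in hc.
(* Here [1 = c * d] with [dag c * c = 1 + 1], so the norm of [d] is inverse to 2. *)
exists (dag d * d); split; last by rewrite dagM dagK mulrC.
by rewrite hc mulrACA -dagM -e dag1 mulr1.
Qed.

(** * Polar decomposition *)

Hypothesis hR : has_square_roots (posElt S).

Lemma polar_exists s : s <> 0 ->
  exists p u, unitary u /\ s = pos_val p * u.
Proof.
move=> s0; have [n hn] := pos_norm s; have [r nr] := hR n.
have hr : dag s * s = pos_val r * pos_val r by rewrite -hn nr expr2.
(* [r] is self-adjoint, so [s] and [r] have equal norms; with second summand 0 the axiom makes [r]
   divide [s]. *)
have [|u [_ [su _]]] := @phased_div S s 0 (pos_val r).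
  by rewrite mulr0 addr0 pos_dag.
exists r, u; split => //.
have rr0 : pos_val r * pos_val r <> 0 by rewrite -hr => /norm_eq0.
apply: (phased_mulfI rr0).
by rewrite mulr1 -[RHS]hr su dagM pos_dag mulrACA.
Qed.

Lemma polar_unique p q u v : pos_val p * u <> 0 ->
  unitary u -> unitary v -> pos_val p * u = pos_val q * v -> p = q /\ u = v.
Proof.
move=> s0 hu hv e.
have pq : p = q.
  (* Unitary factors have norm 1, so comparing norms leaves the squares of [p] and [q]. *)
  apply: pos_sqr_inj.
  have := congr1 (fun x => dag x * x) e.
  by rewrite /= !dagM !pos_dag mulrACA hu mulr1 mulrACA hv mulr1.
split=> //; apply: (@phased_mulfI (pos_val p)); last by rewrite e pq.
by move=> p0; apply: s0; rewrite p0 mul0r.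
Qed.

(** * Signs of self-adjoint elements and the order *)

Lemma sa_pos_or_neg s : dag s = s ->
  exists r, s = pos_val r \/ s = - pos_val r.
Proof.
have [-> _|/eqP s0 hs] := eqVneq s 0.
  by exists 0; left.
have [r [u [hu su]]] := polar_exists s0.
have r0 : pos_val r <> 0 by move=> r0; apply: s0; rewrite su r0 mul0r.
have du : dag u = u.
  by apply: (phased_mulfI r0); rewrite -su -hs su dagM pos_dag.
exists r; have /phased_sqr_eq[u1|u1] : u * u = 1 * 1.
- by rewrite mulr1 -hu du.
- by left; rewrite su u1 mulr1.
- by right; rewrite su u1 mulrN mulr1.
Qed.

Lemma pos_le_anti p q : semiring_le p q -> semiring_le q p -> p = q.
Proof.
case=> c <- [d /(congr1 (@pos_val S)) h].
have h' : pos_val c + pos_val d = 0.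
  by apply: (addrI (pos_val p)); rewrite addrA addr0.
have c0 : c = 0 by apply: pos_val_inj; exact: posD_eq0 h'.
by rewrite c0 addr0.
Qed.

Lemma pos_le_total p q : semiring_le p q \/ semiring_le q p.
Proof.
(* The sign of the self-adjoint difference decides the comparison. *)
have [|r [h|h]] := @sa_pos_or_neg (pos_val p - pos_val q).
- by rewrite dagD dagN !pos_dag.
- right; exists r; apply: pos_val_inj.
  by change (pos_val q + pos_val r = pos_val p); rewrite -h; ring.
- left; exists r; apply: pos_val_inj.
  change (pos_val p + pos_val r = pos_val q).
  by rewrite -[pos_val r]opprK -h; ring.
Qed.

(** * The difference ring and the self-adjoint elements *)

Lemma pos_sub_sa (x : posElt S * posElt S) :
  pos_val x.1 - pos_val x.2 \in @is_sa S.
Proof. by apply/eqP; rewrite dagD dagN !pos_dag. Qed.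

Local Notation diff_class := (\pi_(diffRing (posElt S)))%qT.

Definition pos_sub x : saElt S := SaElt (pos_sub_sa x).

Definition diff_to_sa (x : diffRing (posElt S)) : saElt S := pos_sub (repr x).

(** Independence of the chosen representative: equivalent pairs satisfy the defining equation up to
    a common summand [k], which cancels in [S]. *)
Lemma diff_to_saE x :
  sa_val (diff_to_sa (diff_class x)) =
    pos_val x.1 - pos_val x.2.
Proof.
rewrite /diff_to_sa /=; set y := repr _.
have /diff_relP[k /(congr1 (@pos_val S))] : diff_rel x y.
  by apply/eqmodP; rewrite reprK.
change (pos_val x.1 + pos_val y.2 + pos_val k =
        pos_val x.2 + pos_val y.1 + pos_val k ->
        pos_val y.1 - pos_val y.2 = pos_val x.1 - pos_val x.2).
by move=> h; apply: (eq_of_lincomb (-1) h); ring.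
Qed.

Lemma diff_to_sa_nmod : nmod_morphism diff_to_sa.
Proof.
split; first exact/val_inj/(etrans (diff_to_saE (0, 0)))/subr0.
elim/quotW=> x; elim/quotW=> y; apply: val_inj.
change (sa_val (diff_to_sa (diff_add (diff_class x) (diff_class y))) =
  sa_val (diff_to_sa (diff_class x)) + sa_val (diff_to_sa (diff_class y))).
rewrite -pi_diff_add !diff_to_saE /=.
change (pos_val x.1 + pos_val y.1 - (pos_val x.2 + pos_val y.2) =
  pos_val x.1 - pos_val x.2 + (pos_val y.1 - pos_val y.2)).
by ring.
Qed.

Lemma diff_to_sa_monoid : monoid_morphism diff_to_sa.
Proof.
split; first exact/val_inj/(etrans (diff_to_saE (1, 0)))/subr0.
elim/quotW=> x; elim/quotW=> y; apply: val_inj.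
change (sa_val (diff_to_sa (diff_mul (diff_class x) (diff_class y))) =
  sa_val (diff_to_sa (diff_class x)) * sa_val (diff_to_sa (diff_class y))).
rewrite -pi_diff_mul !diff_to_saE /=.
change (pos_val x.1 * pos_val y.1 + pos_val x.2 * pos_val y.2 -
   (pos_val x.1 * pos_val y.2 + pos_val x.2 * pos_val y.1) =
  (pos_val x.1 - pos_val x.2) * (pos_val y.1 - pos_val y.2)).
by ring.
Qed.

HB.instance Definition _ :=
  GRing.isNmodMorphism.Build _ _ diff_to_sa diff_to_sa_nmod.
HB.instance Definition _ :=
  GRing.isMonoidMorphism.Build _ _ diff_to_sa diff_to_sa_monoid.

Lemma diff_to_sa_bij : bijective diff_to_sa.
Proof.
apply: inj_surj_bijective.
  elim/quotW=> x; elim/quotW=> y /(congr1 (@sa_val S)).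
  rewrite !diff_to_saE => h; apply/eqmodP/diff_step_rel/pos_val_inj.
  change (pos_val x.1 + pos_val y.2 = pos_val x.2 + pos_val y.1).
  by apply: (eq_of_lincomb 1 h); ring.
(* Surjectivity: a positive or negative element comes from a pair with one entry 0. *)
case=> s hs; have [r [e|e]] := sa_pos_or_neg (eqP hs).
  exists (diff_class (r, 0)).
  by apply: val_inj; rewrite [LHS]diff_to_saE [RHS]e; exact: subr0.
exists (diff_class (0, r)).
by apply: val_inj; rewrite [LHS]diff_to_saE [RHS]e; exact: sub0r.
Qed.

(** * Nontrivial involution: imaginary unit, square roots and complex form *)

Lemma imaginary_unit s : dag s <> s ->
  exists i : S, i * i = -1 /\ dag i = - i.
Proof.
move=> hs; have t0 : s - dag s <> 0.
  by move/eqP; rewrite subr_eq0 => /eqP e; apply: hs.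
have [r [u [hu e]]] := polar_exists t0.
have r0 : pos_val r <> 0 by move=> r0; apply: t0; rewrite e r0 mul0r.
have du : dag u = - u.
  (* The element [s - dag s] changes sign under [dag] while [r] is fixed, so the sign passes to
     [u]. *)
  apply: (phased_mulfI r0).
  by rewrite mulrN -e -[X in X * _]pos_dag -dagM -e dagD dagN dagK opprB addrC.
exists u; split => //.
by rewrite -hu du mulNr opprK.
Qed.

Section Imaginary.
Variable i : S.
Hypotheses (i_sqr : i * i = -1) (i_dag : dag i = - i).

Lemma phased_has_square_roots : has_square_roots S.
Proof.
have unitary_root u : unitary u -> exists v, u = v * v.
  move=> hu; have [/eqP|/eqP w0] := eqVneq (1 + u) 0.
    by rewrite addrC addr_eq0 => /eqP ->; exists i.
  have [r [v [hv e]]] := polar_exists w0; exists v.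
  have rr0 : pos_val r * pos_val r <> 0.
    move=> /phased_domain rr; apply: w0.
    by case: rr => rr; rewrite e rr mul0r.
  apply: (phased_mulfI rr0).
  rewrite mulrACA -e.
  have -> : pos_val r * pos_val r = dag (1 + u) * (1 + u).
    by rewrite e dagM pos_dag mulrACA hv mulr1.
  rewrite dagD dag1; move: hu; rewrite /unitary => hu.
  (* Unitarity gives [dag (1 + u) * u = 1 + u]; multiplying by [1 + u] yields the goal. *)
  by apply: (eq_of_lincomb (1 + u) hu); ring.
move=> s; have [->|/eqP s0] := eqVneq s 0; first by exists 0; rewrite expr0n.
have [r [u [hu ->]]] := polar_exists s0.
have [p ->] := hR r; have [v ->] := unitary_root u hu.
by exists (pos_val p * v); rewrite exprMn !expr2.
Qed.

Definition ai_to_phased (x : adjoin_i (saElt S)) : S :=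
  sa_val x.1 + sa_val x.2 * i.

Lemma ai_to_phased_nmod : nmod_morphism ai_to_phased.
Proof.
split=> [|x y]; first by rewrite /ai_to_phased /= mul0r addr0.
change (sa_val x.1 + sa_val y.1 + (sa_val x.2 + sa_val y.2) * i =
  ai_to_phased x + ai_to_phased y).
by rewrite /ai_to_phased; ring.
Qed.

Lemma ai_to_phased_monoid : monoid_morphism ai_to_phased.
Proof.
split=> [|x y]; first by rewrite /ai_to_phased /= mul0r addr0.
change (sa_val x.1 * sa_val y.1 - sa_val x.2 * sa_val y.2 +
  (sa_val x.1 * sa_val y.2 + sa_val x.2 * sa_val y.1) * i =
  ai_to_phased x * ai_to_phased y).
by rewrite /ai_to_phased; ring: i_sqr.
Qed.

Lemma ai_to_phased_dag x : ai_to_phased (dag x) = dag (ai_to_phased x).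
Proof.
rewrite /ai_to_phased dagD dagM i_dag mulrN.
by rewrite (eqP (sa_valP x.1)) (eqP (sa_valP x.2)) /= mulNr.
Qed.

Lemma ai_to_phased_bij : bijective ai_to_phased.
Proof.
have [h [h2 dh]] := two_unit.
apply: inj_surj_bijective => [x y e|s].
  have e' := congr1 (@dag S) e; rewrite -!ai_to_phased_dag in e'.
  move: e e'; case: x y => [a b] [c d]; rewrite /ai_to_phased /= => e e'.
  have two_inj : injective ( *%R (1 + 1 : S)).
    by apply: (can_inj (g := *%R h)) => z; rewrite mulrCA mulrA h2 mul1r.
  congr pair; apply/val_inj/two_inj => /=.
    (* Adding the equation to its conjugate isolates twice the real part; subtracting, then
       multiplying by [- i], isolates twice the imaginary part. *)
    by apply: (eq_of_lincomb 1 (congr2 +%R e e')); ring.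
  by apply: (eq_of_lincomb (- i) (congr2 (fun x y => x - y) e e')); ring: i_sqr.
(* With [h] as one half and [- i] as the inverse of [i], these are the usual real and imaginary
   parts. *)
have re : h * (s + dag s) \in @is_sa S.
  by apply/eqP; rewrite dagM dagD dagK dh addrC.
have im : h * i * (dag s - s) \in @is_sa S.
  by apply/eqP; rewrite !dagM dagD dagN dagK dh i_dag; ring.
exists ((SaElt re, SaElt im) : adjoin_i _); rewrite /ai_to_phased /=.
apply: (eq_of_lincomb s h2).
by ring: i_sqr.
Qed.

End Imaginary.

End PhasedRing.

Theorem lemma8p2 (S : phasedRingType) (hR : has_square_roots (posElt S)) :
  (forall s : S, s <> 0 ->
     exists! p : posElt S * S, unitary p.2 /\ s = pos_val p.1 * p.2) /\
  [/\ forall a : posElt S, semiring_le a a,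
      forall a b c : posElt S,
        semiring_le a b -> semiring_le b c -> semiring_le a c,
      forall a b : posElt S, semiring_le a b -> semiring_le b a -> a = b
    & forall a b : posElt S, semiring_le a b \/ semiring_le b a] /\
  (exists f : {rmorphism diffRing (posElt S) -> saElt S}, bijective f) /\
  ((forall s : S, dag s = s) \/
   (has_square_roots S /\
    exists f : {rmorphism adjoin_i (saElt S) -> S},
      [/\ bijective f,
          forall x : adjoin_i (saElt S), f (dag x) = dag (f x)
        & forall a : saElt S, f (ai_emb a) = sa_val a])).
Proof.
split; [|split; [|split]].
- move=> s s0; have [p [u [hu e]]] := polar_exists hR s0.
  exists (p, u); split=> [//|[q v] /= [hv e']].
  have [||-> -> //] := @polar_unique S p q u v _ hu hv; rewrite -e //.
- split.
  + by move=> a; exists 0; rewrite addr0.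
  + by move=> a b c [d <-] [e <-]; exists (d + e); rewrite addrA.
  + exact: pos_le_anti.
  + exact: pos_le_total.
- by exists (@diff_to_sa S); exact: diff_to_sa_bij.
- have [|/existsNP[s hs]] := pselect (forall s : S, dag s = s); first by left.
  right; have [i [i2 di]] := imaginary_unit hR hs.
  split; first exact: phased_has_square_roots i2.
  (* Multiplicativity depends on [i2], so the morphism is packed locally for this [i]. *)
  pose addM := GRing.isNmodMorphism.Build _ _ (ai_to_phased i)
    (ai_to_phased_nmod i).
  pose mulM := GRing.isMonoidMorphism.Build _ _ (ai_to_phased i)
    (ai_to_phased_monoid i2).
  pose f : {rmorphism adjoin_i (saElt S) -> S} :=
    HB.pack (ai_to_phased i) addM mulM.
  exists f; split.
  + exact: ai_to_phased_bij.
  + exact: ai_to_phased_dag.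
  + by move=> a; rewrite /= /ai_to_phased /= mul0r addr0.
Qed.
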